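(* Let $B$ be a commutative monoid, written additively. The following are equivalent: (a) for all $x,y,u,v\in B$ with $x+y=u+v$, there exists $z\in B$ such that either ($x+z=u$ and $z+v=y$) or ($x=u+z$ and $v=z+y$); (b) for every $a\in B$, the set of decompositions of $a$, ordered by refinement, is filtering, i.e. any two decompositions of $a$ admit a common refinement.
   Context: A decomposition of $a\in B$ is an expression $a=\sum_{i\in I}a_i$ with $a_i\in B$, where the index set $I$ is a non-empty finite totally ordered set. A decomposition $a=\sum_{j\in J}b_j$ is a refinement of $a=\sum_{i\in I}a_i$ if $J$ can be decomposed as a disjoint union $J=\bigcup_{i\in I}J_i$ of non-empty intervals, occurring in $J$ in the order of $I$ (every element of $J_i$ precedes every element of $J_{i'}$ when $i<i'$), such that $a_i=\sum_{j\in J_i}b_j$ for each $i\in I$. *)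

(* Defs.v *)
From HB Require Import structures.
From mathcomp Require Import all_boot all_order all_algebra.
Set Implicit Arguments.
Unset Strict Implicit.
Unset Printing Implicit Defensive.
Import Order.TTheory GRing.Theory.
Local Open Scope ring_scope.

(* The index set is an arbitrary finite totally ordered type, not only 'I_n;
   the display only serves to select notations in the order library. *)
Record decomposition (B : nmodType) (a : B) := Decomposition {
  decomp_disp : Order.disp_t;
  decomp_index : finOrderType decomp_disp;
  decomp_index_gt0 : (0 < #|decomp_index|)%N;
  decomp_term : decomp_index -> B;
  decomp_sum : \sum_(i : decomp_index) decomp_term i = a
}.

Definition order_interval (d : Order.disp_t) (J : finOrderType d)
    (S : {set J}) : Prop :=
  forall j k l : J, j \in S -> l \in S -> (j <= k <= l)%O -> k \in S.

Definition refines (B : nmodType) (a : B) (DJ DI : decomposition a) : Prop :=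
  exists S : decomp_index DI -> {set decomp_index DJ},
    [/\ \bigcup_i S i = [set: decomp_index DJ],
        (forall i i', i != i' -> [disjoint S i & S i']),
        (forall i, S i != set0 /\ order_interval (S i)),
        (forall i i', (i < i')%O ->
           forall j j', j \in S i -> j' \in S i' -> (j < j')%O) &
        (forall i, decomp_term i = \sum_(j in S i) decomp_term j)].

(* Main.v *)
(** For (b) => (a), the first blocks of a common refinement of [x + y] and
    [u + v] are two initial segments of one chain, hence comparable; [z] is the
    sum over their difference.  For (a) => (b), induct on the total number of
    terms: comparing [x + y] with [u + v], where [x], [u] are the first terms
    and [y], [v] the sums of the others, (a) gives for instance [x + z = u] and
    [z + v = y]; a common refinement of [y] and [z + v] preceded by [x] is then
    a common refinement of both decompositions. *)
Require Import Defs.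
From HB Require Import structures.
From mathcomp Require Import all_boot all_order all_algebra.
Set Implicit Arguments.
Unset Strict Implicit.
Unset Printing Implicit Defensive.
Import Order.TTheory GRing.Theory.
Local Open Scope ring_scope.

(* A refinement is encoded by the monotone surjection [f] sending each index
   of the finer sequence to the index of the block containing it. *)
Definition seq_refines (B : nmodType) (r s : seq B) (f : nat -> nat) : Prop :=
  [/\ forall j k, (j <= k < size r)%N -> (f j <= f k)%N,
      forall j, (j < size r)%N -> (f j < size s)%N,
      forall i, (i < size s)%N -> exists2 j, (j < size r)%N & f j = i &
      forall i, (i < size s)%N -> s`_i = \sum_(j < size r | f j == i) r`_j].

Lemma seq_refines_refl (B : nmodType) (s : seq B) : seq_refines s s id.
Proof.
split=> // [j k /andP[] // | i lt_is | i lt_is]; first by exists i.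
by rewrite (big_pred1 (Ordinal lt_is)).
Qed.

Lemma seq_refines_cons (B : nmodType) (x : B) (r s : seq B) (f : nat -> nat) :
  seq_refines r s f ->
  seq_refines (x :: r) (x :: s) (fun j => if j is j'.+1 then (f j').+1 else 0%N).
Proof.
case=> f_homo f_lt f_onto f_sum; split=> /=.
- by case=> [|j] [|k] //; rewrite !ltnS; apply: f_homo.
- by case.
- by case=> [|i lt_is]; [exists 0%N | have [j ? <-] := f_onto i lt_is; exists j.+1].
case=> [|i lt_is]; rewrite big_mkcond big_ord_recl /=.
  by rewrite big1 ?addr0.
by rewrite add0r -big_mkcond; apply: f_sum.
Qed.

(** The new term [x] joins the block of [z], which is block 0, so no block number shifts. *)
Lemma seq_refines_merge (B : nmodType) (x z : B) (r s : seq B)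
    (f : nat -> nat) :
  seq_refines r (z :: s) f ->
  seq_refines (x :: r) (x + z :: s) (fun j => if j is j'.+1 then f j' else 0%N).
Proof.
case=> f_homo f_lt f_onto f_sum; split=> /=.
- by case=> [|j] [|k] //; apply: f_homo.
- by case.
- by move=> i lt_is; have [j ? <-] := f_onto i lt_is; exists j.+1.
case=> [|i] lt_is; rewrite big_mkcond big_ord_recl /= -big_mkcond.
  by congr (_ + _); apply: (f_sum 0%N).
by rewrite add0r; apply: (f_sum i.+1).
Qed.

Lemma seq_refines_sum (B : nmodType) (s : seq B) :
  (0 < size s)%N -> seq_refines s [:: \sum_(x <- s) x] (fun=> 0%N).
Proof.
move=> s_gt0; split=> // -[|i] // _; first by exists 0%N.
by rewrite (big_nth 0) big_mkord.
Qed.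

Lemma seq_refines_sum_eq (B : nmodType) (r s : seq B) (f : nat -> nat) :
  seq_refines r s f -> \sum_(x <- r) x = \sum_(x <- s) x.
Proof.
case=> _ f_lt _ f_sum; rewrite (big_nth 0) [RHS](big_nth 0) !big_mkord.
pose F (j : 'I_(size r)) := Ordinal (f_lt j (ltn_ord j)).
rewrite (partition_big F predT) //=.
by apply: eq_bigr => i _; rewrite f_sum.
Qed.

Lemma seq_common_refinement (B : nmodType) :
  (forall x y u v : B, x + y = u + v ->
     exists z : B, (x + z = u /\ z + v = y) \/ (x = u + z /\ v = z + y)) ->
  forall s t : seq B, (0 < size s)%N -> (0 < size t)%N ->
    \sum_(x <- s) x = \sum_(x <- t) x ->
    exists r f g, seq_refines r s f /\ seq_refines r t g.
Proof.
move=> Ba s t; have [n] := ubnP (size s + size t).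
elim: n s t => // n IHn [|x [|y s]] [|u [|v t]] //= size_lt _ _.
(* When one sequence has a single term, the other is itself a common refinement. In the remaining
   case both tails are non-empty, as the induction hypothesis requires. *)
- by rewrite !big_seq1 => ->; exists [:: u], id, id; split; apply: seq_refines_refl.
- rewrite big_seq1 => ->; exists [:: u, v & t], (fun=> 0%N), id.
  by split; [apply: seq_refines_sum | apply: seq_refines_refl].
- rewrite [RHS]big_seq1 => <-; exists [:: x, y & s], id, (fun=> 0%N).
  by split; [apply: seq_refines_refl | apply: seq_refines_sum].
rewrite big_cons [RHS]big_cons => /Ba[z [[<- eq_y] | [-> eq_v]]].
  (* Dropping [x] on one side and replacing [u] by [z] on the other lowers the total length by
     one. *)
  have [||||r [f [g [rf rg]]]] := IHn (y :: s) (z :: v :: t) => //=.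
    by rewrite [RHS]big_cons.
  exists (x :: r); do 2!eexists.
  by split; [apply: seq_refines_cons rf | apply: seq_refines_merge rg].
have [||||r [f [g [rf rg]]]] := IHn (z :: y :: s) (v :: t) => //=.
- by rewrite addSnnS.
- by rewrite big_cons.
exists (u :: r); do 2!eexists.
by split; [apply: seq_refines_merge rf | apply: seq_refines_cons rg].
Qed.

(** The blocks are the fibres of [f]: surjectivity makes them non-empty, monotonicity makes them
    intervals in the right order. *)
Lemma refines_of_monotone (B : nmodType) (a : B) (DJ DI : decomposition a)
    (f : decomp_index DJ -> decomp_index DI) :
  {homo f : j k / (j <= k)%O} -> (forall i, exists j, f j = i) ->
  (forall i, decomp_term i = \sum_(j | f j == i) decomp_term j) ->
  refines DJ DI.
Proof.
move=> f_homo f_onto f_sum; exists (fun i => [set j | f j == i]); split.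
- apply/setP=> j; rewrite inE; apply/bigcupP.
  by exists (f j); rewrite ?inE.
- move=> i i' neq_ii'; rewrite disjoint_subset; apply/subsetP=> j.
  by rewrite !inE => /eqP->.
- move=> i; split.
    by have [j fj] := f_onto i; apply/set0Pn; exists j; rewrite inE fj.
  move=> j k l; rewrite !inE => /eqP fj /eqP fl /andP[le_jk le_kl].
  by rewrite eq_le -{1}fl -fj !f_homo.
- move=> i i' lt_ii' j j'; rewrite !inE => /eqP fj /eqP fj'.
  by rewrite ltNge; apply: contraL lt_ii' => /f_homo; rewrite fj fj' -leNgt.
by move=> i; rewrite f_sum; apply: eq_bigl => j; rewrite inE.
Qed.

(** [Order.enum_val] is the increasing enumeration of the index set, so positions in the list
    compare as indices do. *)
Definition decomp_seq (B : nmodType) (a : B) (D : decomposition a) : seq B :=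
  [seq decomp_term (Order.enum_val i : decomp_index D)
     | i <- enum 'I_#|decomp_index D|].

Lemma size_decomp_seq (B : nmodType) (a : B) (D : decomposition a) :
  size (decomp_seq D) = #|decomp_index D|.
Proof. by rewrite size_map size_enum_ord. Qed.

Lemma nth_decomp_seq (B : nmodType) (a : B) (D : decomposition a)
    (i : decomp_index D) :
  (decomp_seq D)`_(Order.enum_rank i) = decomp_term i.
Proof.
by rewrite (nth_map (Order.enum_rank i)) ?size_enum_ord // nth_ord_enum
           Order.enum_rankK.
Qed.

Lemma sum_decomp_seq (B : nmodType) (a : B) (D : decomposition a) :
  \sum_(x <- decomp_seq D) x = a.
Proof.
rewrite big_map big_enum /= -[RHS](decomp_sum D).
by rewrite [RHS](reindex _ (onW_bij _ (Order.enum_val_bij (decomp_index D)))).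
Qed.

(** Kept transparent, so that the index type reduces to ['I_(size r)] and the terms to those of
    [r]. *)
Definition decomposition_of_seq (B : nmodType) (a : B) (r : seq B)
    (r_gt0 : (0 < size r)%N) (r_sum : \sum_(x <- r) x = a) : decomposition a.
Proof.
apply: (@Decomposition B a _ 'I_(size r) _ (fun j => r`_j)).
  by rewrite card_ord.
by rewrite -[RHS]r_sum (big_nth 0) big_mkord.
Defined.

Lemma refines_of_seq_refines (B : nmodType) (a : B) (D : decomposition a)
    (r : seq B) (f : nat -> nat)
    (r_gt0 : (0 < size r)%N) (r_sum : \sum_(x <- r) x = a) :
  seq_refines r (decomp_seq D) f -> refines (decomposition_of_seq r_gt0 r_sum) D.
Proof.
case=> f_homo f_lt f_onto f_sum; rewrite size_decomp_seq in f_lt f_onto f_sum.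
pose F (j : 'I_(size r)) : decomp_index D :=
  Order.enum_val (Ordinal (f_lt j (ltn_ord j))).
(* The fibres of [F] are those of [f], relabelled by rank; this carries over surjectivity and the
   block sums. *)
have F_eq j i : (F j == i) = (f j == Order.enum_rank i :> nat).
  exact: (can2_eq (@Order.enum_valK _ _) (@Order.enum_rankK _ _)).
apply: (@refines_of_monotone _ _ (decomposition_of_seq r_gt0 r_sum) _ F).
- move=> j k le_jk; rewrite /F Order.le_enum_val; last exact: le_total.
  by rewrite leEord /=; apply: f_homo; rewrite ltn_ord andbT.
- move=> i; have [j lt_jr fj] := f_onto _ (ltn_ord (Order.enum_rank i)).
  by exists (Ordinal lt_jr); apply/eqP; rewrite F_eq /= fj.
move=> i; rewrite -nth_decomp_seq f_sum //.
by apply: eq_bigl => j; rewrite F_eq.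
Qed.

Lemma common_refinement (B : nmodType) :
  (forall x y u v : B, x + y = u + v ->
     exists z : B, (x + z = u /\ z + v = y) \/ (x = u + z /\ v = z + y)) ->
  forall (a : B) (D1 D2 : decomposition a),
    exists D : decomposition a, refines D D1 /\ refines D D2.
Proof.
move=> Ba a D1 D2.
have [||| r [f [g [rf rg]]]] :=
  seq_common_refinement Ba (s := decomp_seq D1) (t := decomp_seq D2).
- by rewrite size_decomp_seq decomp_index_gt0.
- by rewrite size_decomp_seq decomp_index_gt0.
- by rewrite !sum_decomp_seq.
have r_gt0 : (0 < size r)%N.
  (* The block of the first term of [D1] is inhabited. *)
  case: rf => _ _ f_onto _; have [|j lt_jr _] := f_onto 0%N.
    by rewrite size_decomp_seq decomp_index_gt0.
  exact: leq_ltn_trans lt_jr.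
have r_sum : \sum_(x <- r) x = a.
  by rewrite (seq_refines_sum_eq rf) sum_decomp_seq.
exists (decomposition_of_seq r_gt0 r_sum).
by split; apply: refines_of_seq_refines; [apply: rf | apply: rg].
Qed.

(** In [bool], [false] precedes [true], so [x] sits at [false] and comes first. *)
Definition decomposition2 (B : nmodType) (x y a : B) (xy_a : x + y = a) :
  decomposition a.
Proof.
apply: (@Decomposition B a _ bool _ (fun b => if b then y else x)).
  by rewrite card_bool.
by rewrite big_bool -[RHS]xy_a [RHS]addrC.
Defined.

(** [A] is the block of [x]; the block of [y] is its complement, since the two blocks are disjoint
    and cover. *)
Lemma refines_decomposition2 (B : nmodType) (x y a : B) (xy_a : x + y = a)
    (D : decomposition a) :
  refines D (decomposition2 xy_a) ->
  exists A : {set decomp_index D},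
    [/\ x = \sum_(j in A) decomp_term j,
        y = \sum_(j in ~: A) decomp_term j &
        forall j k, j \in A -> k \notin A -> (j < k)%O].
Proof.
move=> [S [/= S_cover S_disj _ S_lt S_sum]].
have S_true : S true = ~: S false.
  apply/eqP; rewrite eqEsubset -disjoints_subset S_disj //=.
  apply/subsetP=> j; rewrite inE => jSfalse.
  have : j \in \bigcup_i S i by rewrite S_cover inE.
  by case/bigcupP=> -[] // _; rewrite (negPf jSfalse).
exists (S false); split.
- exact: (S_sum false).
- by rewrite -S_true; exact: (S_sum true).
by move=> j k jS kS; apply: (S_lt false true); rewrite // S_true inE.
Qed.

(** Elements [j] of [A] outside [A'] and [k] of [A'] outside [A] would satisfy both [j < k] and
    [k < j]. *)
Lemma initial_segments_comparable (d : Order.disp_t) (J : finOrderType d)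
    (A A' : {set J}) :
  (forall j k, j \in A -> k \notin A -> (j < k)%O) ->
  (forall j k, j \in A' -> k \notin A' -> (j < k)%O) ->
  (A \subset A') || (A' \subset A).
Proof.
move=> A_lt A'_lt; have [//|/subsetPn[j jA jA'] /=] := boolP (A \subset A').
apply/subsetP=> k kA'; apply: contraT => kA.
by have := lt_trans (A_lt _ _ jA kA) (A'_lt _ _ kA' jA'); rewrite ltxx.
Qed.

Lemma sum_subset_interpolation (B : nmodType) (J : finType) (F : J -> B)
    (A A' : {set J}) : A \subset A' ->
  \sum_(j in A) F j + \sum_(j in A' :\: A) F j = \sum_(j in A') F j /\
  \sum_(j in A' :\: A) F j + \sum_(j in ~: A') F j = \sum_(j in ~: A) F j.
Proof.
move=> sAA'; split; apply/esym.
  by rewrite (big_setID A) /= (setIidPr sAA').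
by rewrite (big_setID A') /= setIC -setDE [~: A :\: A']setDE -setCU (setUidPr sAA').
Qed.

Lemma interpolation_of_common_refinement (B : nmodType) :
  (forall (a : B) (D1 D2 : decomposition a),
     exists D : decomposition a, refines D D1 /\ refines D D2) ->
  forall x y u v : B, x + y = u + v ->
    exists z : B, (x + z = u /\ z + v = y) \/ (x = u + z /\ v = z + y).
Proof.
(* The common sum becomes a variable [a], so that both two-term decompositions live in
   [decomposition a]. *)
move=> Bb x y u v; move: {-2}(u + v) (erefl (u + v)) => a uv_a xy_a.
have [D [rDxy rDuv]] := Bb a (decomposition2 xy_a) (decomposition2 (esym uv_a)).
have [A [-> -> A_lt]] := refines_decomposition2 rDxy.
have [A' [-> -> A'_lt]] := refines_decomposition2 rDuv.
have sum_diff := sum_subset_interpolation (@decomp_term _ _ D).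
(* The witness [z] is the sum over [A' :\: A] in the first case and over [A :\: A'] in the
   second. *)
case/orP: (initial_segments_comparable A_lt A'_lt) => /sum_diff[eq1 eq2].
  by eexists; left; split; [apply: eq1 | apply: eq2].
by eexists; right; split; apply: esym; [apply: eq1 | apply: eq2].
Qed.

Theorem proposition5p2 (B : nmodType) :
  (forall x y u v : B, x + y = u + v ->
     exists z : B, (x + z = u /\ z + v = y) \/ (x = u + z /\ v = z + y))
  <->
  (forall (a : B) (D1 D2 : decomposition a),
     exists D : decomposition a, refines D D1 /\ refines D D2).
Proof.
split; first exact: common_refinement.
exact: interpolation_of_common_refinement.
Qed.
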